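(* Let $q\ge0$ with $q\ne1$, and fix a function $g:\mathbb{N}_0\to\mathbb{R}_{>0}$. (1) There exists a rate function $u$ such that the stationary distribution corresponding to $u$ in the PALRMP with parameter $q$ is factorised and a one-point function corresponding to $u$ is given by $f(x,n)=x^n g(n)$. Furthermore, this rate function $u$ is unique up to a constant factor. (2) There exists a rate function $u$ such that the stationary distribution corresponding to $u$ in the PALRMP with parameter $q$ is not factorised, but the stationary distribution corresponding to $u$ in the homogeneous PALRMP with parameter $q$ is factorised and a one-point function corresponding to $u$ is given by $f(n)=g(n)$. (3) There exists a rate function $u$ such that the stationary distribution corresponding to $u$ in the homogeneous PALRMP with parameter $q$ is not factorised, but the stationary distributions corresponding to $u$ in the SLRMP and in the homogeneous SLRMP are factorised, and one-point functions corresponding to $u$ are given by $f(x,n)=x^n g(n)$ for the SLRMP and $f(n)=g(n)$ for the homogeneous SLRMP.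
   Context: $\mathbb{N}=\{1,2,\dots\}$, $\mathbb{N}_0=\mathbb{N}\cup\{0\}$. For $L,N\in\mathbb{N}$, $\Omega_{L,N}=\{\eta=(\eta_1,\dots,\eta_L)\in\mathbb{N}_0^L:\sum_\ell\eta_\ell=N\}$; $\eta_\ell$ is the number of particles at site $\ell$, and sites are arranged on a ring with indices modulo $L$ increasing clockwise. A rate function is $u:\mathbb{N}_0\times\mathbb{N}_0\to\mathbb{R}_{\ge0}$ with $u(m,n)>0$ if $m\ge1$ and $u(0,n)=0$. For sites $k,\ell$, $\eta^{k,\ell}$ is given by $\eta^{k,\ell}_a=\eta_a-\delta_{k,a}+\delta_{\ell,a}$. PALRMP (partially asymmetric long range misanthrope process) with $q\ge0$, rate function $u$ and positive rate parameters $x_1,\dots,x_L$: the continuous-time Markov chain on $\Omega_{L,N}$ in which, from $\eta$, for every ordered pair of distinct sites $k\ne\ell$ with $\eta_k\ge1$: if all sites strictly between $k$ and $\ell$ going right (clockwise, i.e. $k+1,\dots,\ell-1$ mod $L$) are empty, a particle moves right from $k$ to $\ell$ (giving $\eta^{k,\ell}$) at rate $x_\ell u(\eta_k,\eta_\ell)$; if all sites strictly between $k$ and $\ell$ going left (i.e. $k-1,\dots,\ell+1$ mod $L$) are empty, a particle moves left from $k$ to $\ell$ (giving $\eta^{k,\ell}$) at rate $q\,x_\ell u(\eta_k,\eta_\ell)$. If both are possible they count as two transitions and their rates add. The chain is irreducible, so it has a unique stationary distribution. The SLRMP is the PALRMP with $q=1$; ''homogeneous'' means all $x_\ell=1$.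 The stationary distribution corresponding to $u$ in the PALRMP (with given $q$) is factorised if there is $f:\mathbb{R}_{>0}\times\mathbb{N}_0\to\mathbb{R}_{>0}$ such that for all $L,N\in\mathbb{N}$ and all positive $x_1,\dots,x_L$, the stationary distribution on $\Omega_{L,N}$ is $\pi(\eta)=\frac1{Z_{L,N}}\prod_{\ell=1}^L f(x_\ell,\eta_\ell)$, with $Z_{L,N}$ the normalising constant. In the homogeneous PALRMP it is factorised if there is $f:\mathbb{N}_0\to\mathbb{R}_{>0}$ such that for all $L,N\in\mathbb{N}$ it is $\pi(\eta)=\frac1{Z_{L,N}}\prod_{\ell=1}^L f(\eta_\ell)$. Any such $f$ is called a one-point function corresponding to $u$ (it is not unique). *)

(* Defs.v *)
From mathcomp Require Import all_boot all_order all_algebra.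
From mathcomp Require Import reals.

Set Implicit Arguments.
Unset Strict Implicit.
Unset Printing Implicit Defensive.

Import Order.TTheory GRing.Theory Num.Theory.
Local Open Scope ring_scope.

(* Each of the N particles sits somewhere, so every site holds at most N of
   them; bounding the occupation numbers makes the state space a finType. *)
Definition conf (L N : nat) : Type :=
  {c : {ffun 'I_L -> 'I_N.+1} | (\sum_(l < L) (c l : nat) == N)%N}.

Definition occ L N (eta : conf L N) (l : 'I_L) : nat := val eta l.

(* Number of clockwise steps from k to l on the ring Z/LZ. *)
Definition cw L (k l : 'I_L) : nat := ((l + (L - k)) %% L)%N.

(* k+1, ..., l-1 (mod L) are empty. *)
Definition right_clear L N (eta : conf L N) (k l : 'I_L) : bool :=
  [forall a : 'I_L, (0 < cw k a < cw k l)%N ==> (occ eta a == 0)%N].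

(* k-1, ..., l+1 (mod L) are empty; cw a k counts the anticlockwise steps
   from k to a. *)
Definition left_clear L N (eta : conf L N) (k l : 'I_L) : bool :=
  [forall a : 'I_L, (0 < cw a k < cw l k)%N ==> (occ eta a == 0)%N].

(* xi = eta^{k,l}; only used when eta_k >= 1, so that the truncated
   subtraction is exact. *)
Definition is_move L N (eta xi : conf L N) (k l : 'I_L) : bool :=
  [forall a : 'I_L, (occ xi a == occ eta a - (a == k) + (a == l))%N].

Definition rate_function (R : realType) (u : nat -> nat -> R) : Prop :=
  (forall m n, (1 <= m)%N -> 0 < u m n) /\ (forall n, u 0%N n = 0).

Definition jump_rate (R : realType) (q : R) (u : nat -> nat -> R) L N
    (x : 'I_L -> R) (eta xi : conf L N) : R :=
  \sum_(k < L) \sum_(l < L | [&& k != l, (1 <= occ eta k)%N & is_move eta xi k l])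
     (  (if right_clear eta k l then x l * u (occ eta k) (occ eta l) else 0)
      + (if left_clear eta k l then q * x l * u (occ eta k) (occ eta l) else 0)).

Definition generator (R : realType) (q : R) (u : nat -> nat -> R) L N
    (x : 'I_L -> R) (eta xi : conf L N) : R :=
  if eta == xi then - \sum_(zeta : conf L N | zeta != eta) jump_rate q u x eta zeta
  else jump_rate q u x eta xi.

Definition stationary (R : realType) (q : R) (u : nat -> nat -> R) L N
    (x : 'I_L -> R) (pi : conf L N -> R) : Prop :=
  [/\ forall eta, 0 <= pi eta,
      \sum_(eta : conf L N) pi eta = 1
    & forall xi, \sum_(eta : conf L N) pi eta * generator q u x eta xi = 0].

Definition product_measure (R : realType) L N (w : 'I_L -> nat -> R)
    (eta : conf L N) : R :=
  (\prod_(l < L) w l (occ eta l)) /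
  (\sum_(xi : conf L N) \prod_(l < L) w l (occ xi l)).

(* f : R_{>0} x N_0 -> R_{>0}; the values of f at nonpositive reals are junk. *)
Definition one_point (R : realType) (q : R) (u : nat -> nat -> R)
    (f : R -> nat -> R) : Prop :=
  (forall (y : R) (n : nat), 0 < y -> 0 < f y n) /\
  forall L N, (1 <= L)%N -> (1 <= N)%N ->
  forall x : 'I_L -> R, (forall l, 0 < x l) ->
    stationary q u x (@product_measure R L N (fun l => f (x l))).

Definition factorised (R : realType) (q : R) (u : nat -> nat -> R) : Prop :=
  exists f : R -> nat -> R, one_point q u f.

Definition hom_one_point (R : realType) (q : R) (u : nat -> nat -> R)
    (f : nat -> R) : Prop :=
  (forall n, 0 < f n) /\
  forall L N, (1 <= L)%N -> (1 <= N)%N ->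
    stationary q u (fun _ : 'I_L => 1) (@product_measure R L N (fun _ => f)).

Definition hom_factorised (R : realType) (q : R) (u : nat -> nat -> R) : Prop :=
  exists f : nat -> R, hom_one_point q u f.

(* Main.v *)
Require Import Defs.
From mathcomp Require Import all_boot all_order all_algebra.
From mathcomp Require Import reals zify ring lra.

Import Order.TTheory GRing.Theory Num.Theory.
Local Open Scope ring_scope.

Set Implicit Arguments.
Unset Strict Implicit.
Unset Printing Implicit Defensive.

(** Fix a product weight [w], a configuration [xi], and compare the flux out of
[xi] with the flux into it. A particle that has just hopped from [k] to [l]
left the sites strictly between them as it found them, so incoming hops are
indexed by the same pairs [k, l] and the same clear arcs as outgoing ones, and
each contributes a ratio of four weights times a rate
([product_stationaryP]).

On two sites both arcs are always clear, the chain is a birth-death chain, and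
stationarity forces detailed balance ([two_site_balance]). A factorised
stationary law uses the same one-point function on every ring, so detailed
balance for two sites is an identity between the weights of any two sites of
any ring. It says that the flux into [xi] is the flux out of [xi] with the two
directions of rotation exchanged, whatever the one-point function is. What is
left of stationarity ([pair_balanced_stationaryP]) is
    [(1 - q) * \sum_l x l * net_inflow u xi l = 0],
where [net_inflow u xi l] is the rate at which [l] would receive particles
clockwise minus the rate anticlockwise, for [x l = 1]. For [q = 1] nothing is
left; for [q <> 1] the factor [1 - q] drops out.

With free parameters [x], every [net_inflow u xi l] vanishes; at the middle
site of a three-site ring this says that [u m n] is independent of [m] for
[m >= 1] ([factorised_indep_source]). Detailed balance then leaves only the
multiples of [g n.+1 / g n]. Conversely this rate works, because a site has
exactly one nearest occupied site on each side ([clear_diff_sum0]).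

In the homogeneous chain only the sum of the net inflows has to vanish. It
does when rates into empty sites are constant and [u m n - u n m] is a
difference [phi m - phi n] for occupied pairs, since the sum around the ring
then telescopes ([net_inflow_sum0]). This leaves room for a rate that depends
on [m], namely [bumped_rate]. Rates into empty sites must nevertheless be
constant ([hom_factorised_empty_target]); [scaled_rate] violates this while
keeping detailed balance, so it is factorised only for [q = 1]. *)

(** * Clockwise distances and clear arcs *)

Lemma cwE L (k l : 'I_L) : cw k l = (if k <= l then l - k else L + l - k)%N.
Proof.
rewrite /cw; have kL := ltn_ord k; have lL := ltn_ord l.
case: leqP => kl; last by rewrite modn_small; lia.
have -> : (l + (L - k) = L + (l - k))%N by lia.
by rewrite modnDl modn_small; lia.
Qed.

Lemma cw_gt0 L (k l : 'I_L) : (0 < cw k l)%N = (k != l).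
Proof.
rewrite cwE -val_eqE /=; have := ltn_ord k; have := ltn_ord l.
by case: (leqP k l); lia.
Qed.

Lemma cw_injr L (k : 'I_L) : injective (cw k).
Proof.
move=> a b /eqP; rewrite !cwE => ab; apply: val_inj; move: ab => /=.
have := ltn_ord k; have := ltn_ord a; have := ltn_ord b.
by case: (leqP k a); case: (leqP k b); lia.
Qed.

Lemma cw_injl L (l : 'I_L) : injective (fun k => cw k l).
Proof.
move=> a b /eqP; rewrite !cwE => ab; apply: val_inj; move: ab => /=.
have := ltn_ord l; have := ltn_ord a; have := ltn_ord b.
by case: (leqP a l); case: (leqP b l); lia.
Qed.

(** The sites met clockwise from [l] to [k] are those met anticlockwise from
[k] to [l], so one kind of clear arc suffices. *)
Lemma left_clearE L N (eta : conf L N) (k l : 'I_L) :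
  left_clear eta k l = right_clear eta l k.
Proof.
apply: eq_forallb => a; congr (_ ==> _); rewrite !cwE.
have := ltn_ord k; have := ltn_ord a; have := ltn_ord l.
by case: (leqP a k); case: (leqP l k); case: (leqP l a); lia.
Qed.

(** * Configurations and moves *)

Lemma conf_of_occ L N (n : 'I_L -> nat) :
  (\sum_(l < L) n l = N)%N -> exists c : conf L N, forall l, occ c l = n l.
Proof.
move=> nN; have nle l : (n l < N.+1)%N.
  by rewrite ltnS -nN (bigD1 l) //= leq_addr.
pose c := [ffun l => Ordinal (nle l)].
have cN : (\sum_(l < L) (c l : nat) == N)%N.
  by rewrite -[X in _ == X]nN; apply/eqP/eq_bigr => l _; rewrite ffunE.
by exists (exist _ c cN) => l; rewrite /occ /= ffunE.
Qed.

Lemma occ_inj L N (c d : conf L N) : (forall l, occ c l = occ d l) -> c = d.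
Proof.
by move=> cd; apply/val_inj/ffunP => l; apply: val_inj; exact: cd.
Qed.

Lemma occ_sum L N (c : conf L N) : (\sum_(l < L) occ c l = N)%N.
Proof. exact/eqP/(valP c). Qed.

Lemma is_moveP L N (eta xi : conf L N) k l : k != l -> (1 <= occ eta k)%N ->
  reflect [/\ (occ xi k).+1 = occ eta k, occ xi l = (occ eta l).+1
            & forall a, a != k -> a != l -> occ xi a = occ eta a]
          (is_move eta xi k l).
Proof.
move=> kl eta_k; have lk : l != k by rewrite eq_sym.
apply: (iffP forallP) => [mv | [mk ml mo] a].
  split=> [||a /negPf ak /negPf al].
  - by move: (mv k) => /eqP ->; rewrite eqxx (negPf kl); lia.
  - by move: (mv l) => /eqP ->; rewrite eqxx (negPf lk); lia.
  - by move: (mv a) => /eqP ->; rewrite ak al; lia.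
have [->|ak] := eqVneq a k; first by rewrite (negPf kl); lia.
have [->|al] := eqVneq a l; first by rewrite ml; lia.
by rewrite mo //; lia.
Qed.

(** Time reversal of a move. *)
Lemma is_moveC L N (eta xi : conf L N) k l : k != l ->
  ((1 <= occ eta k)%N && is_move eta xi k l) =
  ((1 <= occ xi l)%N && is_move xi eta l k).
Proof.
move=> kl; have lk : l != k by rewrite eq_sym.
apply/andP/andP => -[pos].
  move/(is_moveP _ kl pos) => [mk ml mo].
  have pos' : (1 <= occ xi l)%N by rewrite ml.
  by split=> //; apply/is_moveP => //; split=> // a al ak; rewrite mo.
move/(is_moveP _ lk pos) => [mk ml mo].
have pos' : (1 <= occ eta k)%N by rewrite ml.
by split=> //; apply/is_moveP => //; split=> // a al ak; rewrite mo.
Qed.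

Lemma move_exists L N (eta : conf L N) k l : k != l -> (1 <= occ eta k)%N ->
  exists xi : conf L N, forall zeta, is_move eta zeta k l = (zeta == xi).
Proof.
move=> kl pos; have lk : l != k by rewrite eq_sym.
have sumN : (\sum_(a < L) (occ eta a - (a == k) + (a == l)) = N)%N.
  rewrite -[RHS](occ_sum eta) (bigD1 k) // (bigD1 l) //=.
  rewrite [RHS](bigD1 k) // [in RHS](bigD1 l) //=.
  rewrite !eqxx (negPf kl) (negPf lk).
  rewrite (eq_bigr (occ eta)) => [|a /andP [/negPf -> /negPf ->]]; last first.
    by rewrite subn0 addn0.
  lia.
have [xi xiE] := conf_of_occ sumN.
exists xi => zeta; apply/forallP/eqP => [mv|-> a]; last by rewrite xiE.
by apply: occ_inj => a; rewrite xiE; exact/eqP/mv.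
Qed.

(** Whether an arc is clear depends on its interior only, hence not on the two
sites between which a particle moves. *)
Lemma right_clear_move L N (eta xi : conf L N) k l a b :
  (forall a, a != k -> a != l -> occ xi a = occ eta a) ->
  (a == k) && (b == l) || (a == l) && (b == k) ->
  right_clear xi a b = right_clear eta a b.
Proof.
move=> same ab; apply: eq_forallb => c.
have [->|ca] := eqVneq c a; first by rewrite ltnNge cwE leqnn subnn leqn0.
have [->|cb] := eqVneq c b; first by rewrite ltnn andbF.
by rewrite same //; case/orP: ab => /andP [/eqP ak /eqP bl]; rewrite -?ak -?bl.
Qed.

(** * Stationarity of product measures *)

(** The rate of a hop from [k] to [l] is this factor times [x l * u _ _]. *)
Definition gate (R : realType) (q : R) L N (eta : conf L N) (k l : 'I_L) : R :=
  (right_clear eta k l)%:R + q * (right_clear eta l k)%:R.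

(** Clockwise minus anticlockwise rate of hops to [l], with parameter 1 at [l]
and [q = 1] for the anticlockwise ones. *)
Definition net_inflow (R : realType) (u : nat -> nat -> R) L N (xi : conf L N)
    (l : 'I_L) : R :=
  \sum_(k < L | (k != l) && (1 <= occ xi k)%N)
    ((right_clear xi k l)%:R - (right_clear xi l k)%:R)
      * u (occ xi k) (occ xi l).

Section Balance.
Variables (R : realType) (q : R) (u : nat -> nat -> R) (L N : nat).
Variable x : 'I_L -> R.

Lemma jump_rateE (eta xi : conf L N) :
  jump_rate q u x eta xi =
  \sum_(k < L) \sum_(l < L | [&& k != l, (1 <= occ eta k)%N & is_move eta xi k l])
    gate q eta k l * (x l * u (occ eta k) (occ eta l)).
Proof.
apply: eq_bigr => k _; apply: eq_bigr => l _; rewrite left_clearE /gate.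
by case: ifP => _; case: ifP => _; rewrite /= ?mulr1 ?mulr0; ring.
Qed.

Lemma jump_rate_self (eta : conf L N) : jump_rate q u x eta eta = 0.
Proof.
rewrite jump_rateE big1 // => k _; rewrite big_pred0 // => l.
apply/negP => /and3P [kl pos /(is_moveP _ kl pos) [mk _ _]]; lia.
Qed.

Lemma generator_balance (pi : conf L N -> R) (xi : conf L N) :
  \sum_eta pi eta * generator q u x eta xi =
  \sum_eta pi eta * jump_rate q u x eta xi
  - pi xi * \sum_zeta jump_rate q u x xi zeta.
Proof.
rewrite (bigD1 xi) //= [in RHS](bigD1 xi) //= [X in _ - _ * X](bigD1 xi) //=.
rewrite jump_rate_self mulr0 !add0r /generator eqxx mulrN addrC.
by congr (_ - _); apply: eq_bigr => eta /negPf ->.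
Qed.

Lemma exit_rate (xi : conf L N) :
  \sum_zeta jump_rate q u x xi zeta =
  \sum_(k < L) \sum_(l < L | (k != l) && (1 <= occ xi k)%N)
    gate q xi k l * (x l * u (occ xi k) (occ xi l)).
Proof.
under eq_bigr do rewrite jump_rateE.
rewrite exchange_big; apply: eq_bigr => k _ /=.
rewrite (exchange_big_dep (fun l => (k != l) && (1 <= occ xi k)%N)) /=; last first.
  by move=> z l _ /and3P [-> ->].
apply: eq_bigr => l /andP [kl pos].
have [xi' xiE] := @move_exists _ _ xi _ _ kl pos.
by rewrite (big_pred1 xi') // => z; rewrite kl pos /= xiE.
Qed.

Variable w : 'I_L -> nat -> R.
Hypothesis w_gt0 : forall l n, 0 < w l n.

(** The configurations that can enter [xi] by a hop from [k] to [l] reduce to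
one, obtained by moving a particle of [xi] back from [l] to [k]; its weight
differs from that of [xi] in these two factors only. *)
Lemma entrance_rate (xi : conf L N) :
  \sum_eta (\prod_(l < L) w l (occ eta l)) * jump_rate q u x eta xi =
  (\prod_(l < L) w l (occ xi l)) *
  \sum_(k < L) \sum_(l < L | (k != l) && (1 <= occ xi l)%N)
    w k (occ xi k).+1 * w l (occ xi l).-1 / (w k (occ xi k) * w l (occ xi l)) *
    (gate q xi k l * (x l * u (occ xi k).+1 (occ xi l).-1)).
Proof.
under eq_bigr do rewrite jump_rateE mulr_sumr.
rewrite exchange_big mulr_sumr; apply: eq_bigr => k _ /=.
under eq_bigr do rewrite mulr_sumr.
rewrite (exchange_big_dep (fun l => (k != l) && (1 <= occ xi l)%N)) /=; last first.
  by move=> eta l _ /andP [kl]; rewrite is_moveC // kl => /andP [->].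
rewrite mulr_sumr; apply: eq_bigr => l /andP [kl pos].
have lk : l != k by rewrite eq_sym.
have [eta etaE] := @move_exists _ _ xi _ _ lk pos.
rewrite (big_pred1 eta) => [|z]; last by rewrite is_moveC // kl pos /= etaE.
have /(is_moveP _ lk pos) [ml mk mo] : is_move xi eta l k by rewrite etaE.
have gE : gate q eta k l = gate q xi k l.
  by rewrite /gate !(@right_clear_move _ _ xi eta l k) ?eqxx ?orbT.
rewrite gE mk -ml /=.
rewrite (bigD1 k) // (bigD1 l) //= [in RHS](bigD1 k) // [in RHS](bigD1 l) //=.
rewrite mk -ml.
rewrite (eq_bigr (fun a => w a (occ xi a))) => [|a /andP [ak al]]; last by rewrite mo.
have := lt0r_neq0 (w_gt0 k (occ xi k)).
have := lt0r_neq0 (w_gt0 l (occ eta l).+1).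
by move=> wl wk; field; rewrite wl wk.
Qed.

(** Both sides are fluxes divided by the probability of [xi]: incoming on the
left, outgoing on the right. *)
Lemma product_stationaryP : (0 < L)%N ->
  stationary q u x (@product_measure R L N w) <->
  forall xi : conf L N,
  \sum_(k < L) \sum_(l < L | (k != l) && (1 <= occ xi l)%N)
    w k (occ xi k).+1 * w l (occ xi l).-1 / (w k (occ xi k) * w l (occ xi l)) *
    (gate q xi k l * (x l * u (occ xi k).+1 (occ xi l).-1)) =
  \sum_(k < L) \sum_(l < L | (k != l) && (1 <= occ xi k)%N)
    gate q xi k l * (x l * u (occ xi k) (occ xi l)).
Proof.
move=> L_gt0; pose W (eta : conf L N) := \prod_(l < L) w l (occ eta l).
have W_gt0 eta : 0 < W eta by apply: prodr_gt0.
have Z_gt0 : 0 < \sum_eta W eta.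
  have sumN : (\sum_(l < L) (if l == Ordinal L_gt0 then N else 0) = N)%N.
    by rewrite -big_mkcond big_pred1_eq.
  have [c _] := conf_of_occ sumN.
  rewrite (bigD1 c) //=; apply: ltr_wpDr => //.
  by apply: sumr_ge0 => eta _; exact: ltW.
have Z_neq0 := lt0r_neq0 Z_gt0.
have balE (xi : conf L N) :
    \sum_eta product_measure w eta * generator q u x eta xi =
    W xi / (\sum_eta W eta) *
    (\sum_(k < L) \sum_(l < L | (k != l) && (1 <= occ xi l)%N)
      w k (occ xi k).+1 * w l (occ xi l).-1 / (w k (occ xi k) * w l (occ xi l)) *
      (gate q xi k l * (x l * u (occ xi k).+1 (occ xi l).-1)) -
    \sum_(k < L) \sum_(l < L | (k != l) && (1 <= occ xi k)%N)
      gate q xi k l * (x l * u (occ xi k) (occ xi l))).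
  rewrite generator_balance exit_rate mulrBr; congr (_ - _).
  rewrite mulrAC -[X in _ = X / _]entrance_rate mulr_suml.
  by apply: eq_bigr => eta _; rewrite mulrAC.
split=> [[_ _ st] xi | bal].
  apply/eqP; rewrite -subr_eq0; apply/eqP.
  apply: (mulfI (lt0r_neq0 (divr_gt0 (W_gt0 xi) Z_gt0))).
  by rewrite mulr0 -balE.
split=> [eta||xi].
- exact: ltW (divr_gt0 (W_gt0 eta) Z_gt0).
- by rewrite -mulr_suml mulfV.
- by rewrite balE bal subrr mulr0.
Qed.

(** Detailed balance between two sites [k] and [l] on which a particle hops with
no regard to the rest of the ring. *)
Definition pair_balanced :=
  forall k l, k != l -> forall a b,
    w k a.+1 * w l b * (x l * u a.+1 b) = w k a * w l b.+1 * (x k * u b.+1 a).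

(** Detailed balance turns the rate of an incoming hop from [k] to [l] into that
of an outgoing hop from [l] to [k] over the same arc. So an outgoing hop
occurs with factor 1 over its own arc against [q] from the reversed direction,
and conversely, which leaves a common factor [1 - q]. *)
Lemma pair_balanced_stationaryP : (0 < L)%N -> pair_balanced ->
  stationary q u x (@product_measure R L N w) <->
  forall xi : conf L N,
  (1 - q) * \sum_(l < L) x l * net_inflow u xi l = 0.
Proof.
move=> L_gt0 bal.
have eqE (xi : conf L N) :
  \sum_(k < L) \sum_(l < L | (k != l) && (1 <= occ xi k)%N)
    gate q xi k l * (x l * u (occ xi k) (occ xi l)) -
  \sum_(k < L) \sum_(l < L | (k != l) && (1 <= occ xi l)%N)
    w k (occ xi k).+1 * w l (occ xi l).-1 / (w k (occ xi k) * w l (occ xi l)) *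
    (gate q xi k l * (x l * u (occ xi k).+1 (occ xi l).-1)) =
  (1 - q) * \sum_(l < L) x l * net_inflow u xi l.
  rewrite (exchange_big_dep predT) //= -sumrB mulr_sumr.
  apply: eq_bigr => l _.
  rewrite mulrA /net_inflow mulr_sumr.
  rewrite [X in _ - X](eq_bigl (fun k => (k != l) && (1 <= occ xi k)%N)); last first.
    by move=> k; rewrite eq_sym.
  rewrite -sumrB; apply: eq_bigr => k /andP [kl pos].
  have := bal l k; rewrite eq_sym => /(_ kl (occ xi l) (occ xi k).-1).
  rewrite prednK // => balE.
  have wl := lt0r_neq0 (w_gt0 l (occ xi l)).
  have wk := lt0r_neq0 (w_gt0 k (occ xi k)).
  rewrite mulrAC [X in _ - X / _]mulrCA balE.
  by rewrite /gate; field; rewrite wl wk.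
split=> [/product_stationaryP st xi | st].
  by rewrite -eqE st // subrr.
apply/product_stationaryP => // xi; apply/esym/eqP; rewrite -subr_eq0.
by apply/eqP; rewrite eqE.
Qed.
End Balance.

(** * Net inflow around the ring *)

Lemma sum_argmin (R : pzSemiRingType) (T : finType) (d : T -> nat) (P : pred T) :
  injective d ->
  \sum_(k | P k) ([forall a, P a ==> (d k <= d a)%N])%:R = [exists k, P k]%:R :> R.
Proof.
move=> d_inj; case: existsP => [[k0 Pk0] | noP]; last first.
  by rewrite big_pred0 // => k; apply/negP => Pk; apply: noP; exists k.
have [k Pk kmin] := arg_minnP d Pk0.
rewrite (bigD1 k) //= big1 => [|j /andP [Pj jk]].
  by rewrite addr0 (introT forallP) // => a; apply/implyP/kmin.
rewrite (_ : [forall a, _] = false) //; apply: contraNF jk => /forallP /(_ k).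
by rewrite Pk /= => jk; apply/eqP/d_inj/eqP; rewrite eqn_leq jk kmin.
Qed.

(** Among the occupied sites [k != l], the arc from [l] to [k] is clear exactly
for the one nearest to [l]. *)
Lemma clear_from_count (R : realType) L N (xi : conf L N) (l : 'I_L) :
  \sum_(k < L | (k != l) && (1 <= occ xi k)%N) (right_clear xi l k)%:R =
  [exists k : 'I_L, (k != l) && (1 <= occ xi k)%N]%:R :> R.
Proof.
rewrite -(sum_argmin _ _ (@cw_injr L l)); apply: eq_bigr => k /andP [kl _].
congr (nat_of_bool _)%:R; apply: eq_forallb => a.
rewrite cw_gt0 eq_sym [(cw l k <= _)%N]leqNgt.
by case: (a != l) (cw l a < cw l k)%N (occ xi a) => [] [] [].
Qed.

Lemma clear_to_count (R : realType) L N (xi : conf L N) (l : 'I_L) :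
  \sum_(k < L | (k != l) && (1 <= occ xi k)%N) (right_clear xi k l)%:R =
  [exists k : 'I_L, (k != l) && (1 <= occ xi k)%N]%:R :> R.
Proof.
rewrite -(sum_argmin _ _ (@cw_injl L l)); apply: eq_bigr => k /andP [kl _].
rewrite -left_clearE; congr (nat_of_bool _)%:R; apply: eq_forallb => a.
rewrite cw_gt0 [(cw k l <= _)%N]leqNgt.
by case: (a != l) (cw a l < cw k l)%N (occ xi a) => [] [] [].
Qed.

Lemma clear_diff_sum0 (R : realType) L N (xi : conf L N) (l : 'I_L) :
  \sum_(k < L | (k != l) && (1 <= occ xi k)%N)
    ((right_clear xi k l)%:R - (right_clear xi l k)%:R) = 0 :> R.
Proof. by rewrite sumrB clear_from_count clear_to_count subrr. Qed.

Lemma antisym_sum0 (R : realType) (I : finType) (P : rel I) (D : I -> I -> R) :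
  (forall k l, P k l = P l k) -> (forall k l, P k l -> D k l = - D l k) ->
  \sum_l \sum_(k | P k l) D k l = 0.
Proof.
move=> Psym Danti; set S := \sum_l _.
suff : S = - S by lra.
rewrite {1}/S (exchange_big_dep predT) //= -sumrN; apply: eq_bigr => k _.
rewrite -sumrN (eq_bigl (P^~ k)) => [|l]; last by rewrite Psym.
by apply: eq_bigr => l Plk; rewrite Danti // Psym.
Qed.

(** Empty targets contribute nothing as their rate is constant. For occupied
[k, l] the coefficient of the rate is antisymmetric, and the hypothesis makes
[u _ _ + phi _] symmetric; adding [phi (occ xi l)] to all rates into [l] does
not change the net inflow, so the sum vanishes by antisymmetry. *)
Lemma net_inflow_sum0 (R : realType) (u : nat -> nat -> R) (c : R) (phi : nat -> R)
    L N (xi : conf L N) :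
  (forall m, (1 <= m)%N -> u m 0%N = c) ->
  (forall m n, (1 <= m)%N -> (1 <= n)%N -> u m n - u n m = phi m - phi n) ->
  \sum_(l < L) net_inflow u xi l = 0.
Proof.
move=> u0 uphi.
pose D k l : R := (right_clear xi k l)%:R - (right_clear xi l k)%:R.
pose P k l := [&& k != l, (1 <= occ xi k)%N & (1 <= occ xi l)%N].
transitivity (\sum_(l < L) \sum_(k < L | P k l)
    D k l * (u (occ xi k) (occ xi l) + phi (occ xi l))); last first.
  apply: antisym_sum0 => [k l|k l /and3P [_ k1 l1]].
    by rewrite /P eq_sym [X in _ && X]andbC.
  by rewrite /D; have := uphi _ _ k1 l1 => /eqP; rewrite subr_eq => /eqP ->; ring.
apply: eq_bigr => l _; case: (posnP (occ xi l)) => l1.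
  rewrite [RHS]big_pred0 => [|k]; last by rewrite /P l1 !andbF.
  transitivity (\sum_(k < L | (k != l) && (1 <= occ xi k)%N) D k l * c); last first.
    by rewrite -mulr_suml clear_diff_sum0 mul0r.
  by apply: eq_bigr => k /andP [_ k1]; rewrite l1 u0.
rewrite [RHS](eq_bigl (fun k => (k != l) && (1 <= occ xi k)%N)) => [|k]; last first.
  by rewrite /P l1 andbT.
under [RHS]eq_bigr do rewrite mulrDr.
by rewrite big_split -mulr_suml clear_diff_sum0 mul0r /= addr0.
Qed.

Lemma net_inflow_indep_source0 (R : realType) (u : nat -> nat -> R)
    L N (xi : conf L N) (l : 'I_L) :
  (forall m n, (1 <= m)%N -> u m n = u 1%N n) -> net_inflow u xi l = 0.
Proof.
move=> u1; rewrite -[RHS](mul0r (u 1%N (occ xi l))).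
rewrite -[X in X * _](clear_diff_sum0 R xi l) mulr_suml.
by apply: eq_bigr => k /andP [_ k1]; rewrite u1.
Qed.

(** * Necessary conditions from rings with two and three sites *)

Lemma right_clear_adjacent L N (xi : conf L N) (k l : 'I_L) :
  cw k l = 1%N -> right_clear xi k l.
Proof. by move=> kl; apply/forallP => a; rewrite kl; case: (cw k a). Qed.

Lemma right_clear_over L N (xi : conf L N) (k a l : 'I_L) :
  cw k a = 1%N -> cw k l = 2%N -> right_clear xi k l = (occ xi a == 0)%N.
Proof.
move=> ka kl; apply/forallP/idP => [/(_ a)|a0 b]; first by rewrite ka kl.
apply/implyP; rewrite kl => kb; have -> // : b = a.
by apply: (@cw_injr _ k); rewrite ka; lia.
Qed.

(** On a two-site ring the configurations with [N] particles form a line, and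
the probability current along a line that a stationary law carries is constant
and vanishes at the ends. *)
Lemma two_site_balance (R : realType) (q : R) (u : nat -> nat -> R)
    (x : 'I_2 -> R) (w : 'I_2 -> nat -> R) : 0 <= q -> (forall l n, 0 < w l n) ->
  (forall N, (1 <= N)%N -> stationary q u x (@product_measure R 2 N w)) ->
  forall a b, w ord0 a.+1 * w ord_max b * (x ord_max * u a.+1 b) =
              w ord0 a * w ord_max b.+1 * (x ord0 * u b.+1 a).
Proof.
move=> q_ge0 w_gt0 st.
have sum2 (F : 'I_2 -> R) : \sum_l F l = F ord0 + F ord_max.
  by rewrite big_ord_recl big_ord1; congr (_ + F _); apply: val_inj.
have gateE N (eta : conf 2 N) k l : cw k l = 1%N -> cw l k = 1%N ->
    gate q eta k l = 1 + q.
  by move=> kl lk; rewrite /gate !right_clear_adjacent // mulr1.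
(* J a b is the current from (a+1, b) to (a, b+1), up to the factor 1 + q and
   normalisation. *)
pose J a b := w ord0 a.+1 * w ord_max b * (x ord_max * u a.+1 b) -
              w ord0 a * w ord_max b.+1 * (x ord0 * u b.+1 a).
have flux m n : (1 <= m + n)%N ->
    (if n is n'.+1 then J m n' else 0) = (if m is m'.+1 then J m' n else 0).
  move=> mn.
  have [|xi xiE] := @conf_of_occ 2 (m + n) (fun l => if l == ord0 then m else n).
    by rewrite big_ord_recl big_ord1.
  have /product_stationaryP := st _ mn.
  move=> /(_ w_gt0 isT xi); rewrite !sum2 !(big_mkcond (fun l => _ && _)) !sum2 /=.
  rewrite !gateE // !xiE /=.
  have w0 := lt0r_neq0 (w_gt0 ord0 m); have w1 := lt0r_neq0 (w_gt0 ord_max n).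
  have q1 : 1 + q != 0 by lra.
  have c0 : (1 + q) / (w ord0 m * w ord_max n) != 0.
    by rewrite mulf_neq0 // invr_eq0 mulf_neq0.
  move=> E; apply: (mulfI c0); move: E w0 w1; rewrite /J; clear.
  case: m n => [|m] [|n] //= /eqP; rewrite ?add0r ?addr0 -subr_eq0 => /eqP E w0 w1.
  - apply/eqP; rewrite -subr_eq0 -[X in _ == X]E; apply/eqP; field.
    by rewrite w0 w1.
  - apply/eqP; rewrite -subr_eq0 -[X in _ == X]E; apply/eqP; field.
    by rewrite w0 w1.
  - apply/eqP; rewrite -subr_eq0 -[X in _ == X]E; apply/eqP; field.
    by rewrite w0 w1.
have J0 a b : J a b = 0.
  elim: a b => [|a IHa] b; first by have := flux 0 b.+1 isT.
  by have := flux a.+1 b.+1 isT; rewrite IHa.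
by move=> a b; apply/eqP; rewrite -subr_eq0; apply/eqP/J0.
Qed.

Lemma one_point_balance (R : realType) (q : R) (u : nat -> nat -> R)
    (f : R -> nat -> R) : 0 <= q -> one_point q u f ->
  forall y z, 0 < y -> 0 < z -> forall a b,
    f y a.+1 * f z b * (z * u a.+1 b) = f y a * f z b.+1 * (y * u b.+1 a).
Proof.
move=> q_ge0 [f_gt0 st] y z y0 z0; pose x (l : 'I_2) := if l == ord0 then y else z.
have x_gt0 l : 0 < x l by rewrite /x; case: ifP.
apply: (@two_site_balance _ q u x (fun l => f (x l))) => // [l n|N N1].
  exact: f_gt0.
exact: st.
Qed.

(** Detailed balance between two sites with equal parameters and weight [g]. *)
Definition reversible_for (R : realType) (g : nat -> R) (u : nat -> nat -> R) :=
  forall m n, g m.+1 * g n * u m.+1 n = g m * g n.+1 * u n.+1 m.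

Lemma hom_one_point_balance (R : realType) (q : R) (u : nat -> nat -> R)
    (f : nat -> R) : 0 <= q -> hom_one_point q u f ->
  reversible_for f u.
Proof.
move=> q_ge0 [f_gt0 st] a b.
have := @two_site_balance _ q u (fun=> 1) (fun=> f) q_ge0 (fun=> f_gt0) _ a b.
by rewrite !mul1r; apply => N N1; exact: st.
Qed.

Lemma three_site_conf m n p :
  exists xi : conf 3 (m + n + p),
    [/\ occ xi ord0 = m, occ xi (lift ord0 ord0) = n & occ xi ord_max = p].
Proof.
have [|xi xiE] := @conf_of_occ 3 (m + n + p) (fun l => nth 0%N [:: m; n; p] l).
  by rewrite !big_ord_recl big_ord0 /= addn0 addnA.
by exists xi; rewrite !xiE.
Qed.

Lemma sum3 (R : realType) (F : 'I_3 -> R) :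
  \sum_l F l = F ord0 + F (lift ord0 ord0) + F ord_max.
Proof.
rewrite !big_ord_recl big_ord0 addr0 addrA; congr (_ + F _).
exact: val_inj.
Qed.

(** Doubling one parameter, all equal to 1, isolates its coefficient. *)
Lemma positive_linear_form0 (R : realType) (I : finType) (E : I -> R) :
  (forall x : I -> R, (forall i, 0 < x i) -> \sum_i x i * E i = 0) ->
  forall i, E i = 0.
Proof.
move=> E0 i.
have := E0 (fun j => 1 + (j == i)%:R) (fun j => ltr_pwDl ltr01 (ler0n R _)).
under eq_bigr do rewrite mulrDl.
rewrite big_split (E0 (fun=> 1)) //= add0r => <-.
by rewrite (bigD1 i) //= eqxx mul1r big1 ?addr0 // => j /negPf ->; rewrite mul0r.
Qed.

Lemma three_site_inflow (R : realType) (u : nat -> nat -> R) N (xi : conf 3 N) :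
  (1 <= occ xi ord0)%N -> (1 <= occ xi ord_max)%N ->
  net_inflow u xi (lift ord0 ord0) =
  u (occ xi ord0) (occ xi (lift ord0 ord0))
  - u (occ xi ord_max) (occ xi (lift ord0 ord0)).
Proof.
move=> m1 p1; rewrite /net_inflow big_mkcond sum3 /= m1 p1.
rewrite !(@right_clear_adjacent _ _ _ ord0 (lift ord0 ord0)) //.
rewrite !(@right_clear_adjacent _ _ _ (lift ord0 ord0) ord_max) //.
rewrite !(@right_clear_over _ _ _ (lift ord0 ord0) ord_max ord0) //.
rewrite !(@right_clear_over _ _ _ ord_max ord0 (lift ord0 ord0)) //.
by rewrite !eqn0Ngt m1 p1 /=; ring.
Qed.

(** The parameters being free, the net inflow vanishes site by site. At a site
whose two neighbours are occupied it compares one rate from each of them. *)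
Lemma factorised_indep_source (R : realType) (q : R) (u : nat -> nat -> R) :
  0 <= q -> q <> 1 -> factorised q u ->
  forall m p n, (1 <= m)%N -> (1 <= p)%N -> u m n = u p n.
Proof.
move=> q_ge0 /eqP q1 [f op] m p n m1 p1; have [f_gt0 st] := op.
have [xi [xi0 xi1 xi2]] := three_site_conf m n p.
have inflow0 : forall l, net_inflow u xi l = 0.
  apply: positive_linear_form0 => x x_gt0.
  have w_gt0 l k : 0 < f (x l) k by exact: f_gt0.
  have bal : pair_balanced u x (fun l => f (x l)).
    by move=> k l _ a b; exact: (one_point_balance q_ge0 op).
  have N1 : (1 <= m + n + p)%N by lia.
  have [/(_ (st 3%N _ isT N1 x x_gt0) xi) /eqP + _] :=
    pair_balanced_stationaryP q (m + n + p) w_gt0 isT bal.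
  by rewrite mulf_eq0 subr_eq0 eq_sym (negPf q1) => /eqP.
have := inflow0 (lift ord0 ord0).
rewrite three_site_inflow ?xi0 ?xi1 ?xi2 // => /eqP.
by rewrite subr_eq0 => /eqP.
Qed.

(** If the middle one of three sites is empty, the outer two see each other
over clear arcs on both sides, so the inflow into the middle site must vanish
by itself. *)
Lemma hom_factorised_empty_target (R : realType) (q : R) (u : nat -> nat -> R) :
  0 <= q -> q <> 1 -> hom_factorised q u ->
  forall m p, (1 <= m)%N -> (1 <= p)%N -> u m 0%N = u p 0%N.
Proof.
move=> q_ge0 /eqP q1 [f op] m p m1 p1; have [f_gt0 st] := op.
have [xi [xi0 xi1 xi2]] := three_site_conf m 0 p.
have bal : pair_balanced u (fun _ : 'I_3 => 1) (fun=> f).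
  by move=> k l _ a b; rewrite !mul1r; exact: (hom_one_point_balance q_ge0 op).
have N1 : (1 <= m + 0 + p)%N by lia.
have [/(_ (st 3%N _ isT N1) xi) /eqP + _] :=
  pair_balanced_stationaryP q (m + 0 + p) (fun _ : 'I_3 => f_gt0) isT bal.
rewrite mulf_eq0 subr_eq0 eq_sym (negPf q1) sum3 !mul1r /=.
rewrite three_site_inflow ?xi0 ?xi1 ?xi2 //.
have clear_outer : right_clear xi ord0 ord_max.
  by rewrite (@right_clear_over _ _ _ ord0 (lift ord0 ord0)) // xi1.
have -> : net_inflow u xi ord0 = 0.
  rewrite /net_inflow big_mkcond sum3 /= xi1 clear_outer /=.
  by rewrite right_clear_adjacent // subrr mul0r if_same !addr0.
have -> : net_inflow u xi ord_max = 0.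
  rewrite /net_inflow big_mkcond sum3 /= xi1 clear_outer /=.
  by rewrite right_clear_adjacent // subrr mul0r if_same !addr0.
by rewrite add0r addr0 subr_eq0 => /eqP.
Qed.

(** * Sufficient conditions *)

Lemma reversible_one_point (R : realType) (q : R) (u : nat -> nat -> R)
    (g : nat -> R) : (forall n, 0 < g n) -> reversible_for g u ->
  (forall L N (x : 'I_L -> R) (xi : conf L N),
     (1 - q) * \sum_(l < L) x l * net_inflow u xi l = 0) ->
  one_point q u (fun x n => x ^+ n * g n).
Proof.
move=> g_gt0 rev inflow0; split=> [y n y0|L N L1 N1 x x_gt0].
  by rewrite mulr_gt0 // exprn_gt0.
apply/pair_balanced_stationaryP => // [l n|k l _ a b].
  by rewrite mulr_gt0 // exprn_gt0.
transitivity (x k ^+ a.+1 * x l ^+ b.+1 * (g a.+1 * g b * u a.+1 b)).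
  by rewrite !exprS; ring.
by rewrite rev !exprS; ring.
Qed.

Lemma reversible_hom_one_point (R : realType) (q : R) (u : nat -> nat -> R)
    (g : nat -> R) : (forall n, 0 < g n) -> reversible_for g u ->
  (forall L N (xi : conf L N), (1 - q) * \sum_(l < L) net_inflow u xi l = 0) ->
  hom_one_point q u g.
Proof.
move=> g_gt0 rev inflow0; split=> // L N L1 N1.
apply/pair_balanced_stationaryP => // [k l _ a b|xi].
  by rewrite !mul1r.
by under eq_bigr do rewrite mul1r.
Qed.

(** * Three rates reversible for a given weight *)

Definition target_rate (R : realType) (g : nat -> R) (m n : nat) : R :=
  if m == 0%N then 0 else g n.+1 / g n.

(** Times [g m * g n], the added term is a function of [m + n] on the region
[m >= 2], [n >= 1], which the reversal [(m, n) -> (n.+1, m.-1)] preserves.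
For [m, n >= 1] only pairs with exactly one of [m, n] equal to 1 change the
term when [m] and [n] are exchanged; they change it by 1, so that its
antisymmetrisation is a difference of values of the indicator of [2 <= _]. *)
Definition bumped_rate (R : realType) (g : nat -> R) (m n : nat) : R :=
  target_rate g m n +
  (if (2 <= m)%N && (1 <= n)%N then g 1%N * g (m + n).-1 / (g m * g n) else 0).

(** A hop does not change [m + n], so this factor preserves reversibility, but
it makes the rate into an empty site depend on [m]. *)
Definition scaled_rate (R : realType) (g : nat -> R) (m n : nat) : R :=
  (m + n)%:R * target_rate g m n.

Section Rates.
Variables (R : realType) (g : nat -> R).
Hypothesis g_gt0 : forall n, 0 < g n.

Let g_neq0 n : g n != 0 := lt0r_neq0 (g_gt0 n).

Lemma target_rateP : rate_function (target_rate g).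
Proof.
by split=> [m n|//]; rewrite lt0n /target_rate => /negPf ->; rewrite divr_gt0.
Qed.

Lemma target_rate_reversible : reversible_for g (target_rate g).
Proof. by move=> m n; rewrite /target_rate /=; field; rewrite !g_neq0. Qed.

Lemma bumped_rateP : rate_function (bumped_rate g).
Proof.
split=> [m n m1|n]; last by rewrite /bumped_rate addr0 target_rateP.2.
apply: ltr_wpDr; last exact: target_rateP.1.
by case: ifP => // _; rewrite ltW // divr_gt0 // mulr_gt0.
Qed.

Lemma bumped_rate_reversible : reversible_for g (bumped_rate g).
Proof.
move=> m n; rewrite /bumped_rate !mulrDr target_rate_reversible; congr (_ + _).
rewrite !ltnS [(0 < n)%N && _]andbC [(n.+1 + m)%N]addSnnS addnC -addSnnS.
by case: ifP => _; [field; rewrite !g_neq0 | rewrite !mulr0].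
Qed.

Lemma bumped_rate_empty m : (1 <= m)%N -> bumped_rate g m 0 = g 1%N / g 0%N.
Proof. by rewrite lt0n /bumped_rate /target_rate andbF addr0 => /negPf ->. Qed.

Lemma bumped_rate_cocycle m n : (1 <= m)%N -> (1 <= n)%N ->
  bumped_rate g m n - bumped_rate g n m =
  ((2 <= m)%N%:R - g m.+1 / g m) - ((2 <= n)%N%:R - g n.+1 / g n).
Proof.
rewrite /bumped_rate /target_rate [(n + m)%N]addnC.
case: m n => [|[|m]] [|[|n]] // _ _ /=.
- by ring.
- by field; rewrite !g_neq0.
- by rewrite addn1 /=; field; rewrite !g_neq0.
- by field; rewrite !g_neq0.
Qed.

Lemma scaled_rateP : rate_function (scaled_rate g).
Proof.
split=> [m n m1|n]; last by rewrite /scaled_rate target_rateP.2 mulr0.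
by rewrite mulr_gt0 ?target_rateP.1 // ltr0n addn_gt0 m1.
Qed.

Lemma scaled_rate_reversible : reversible_for g (scaled_rate g).
Proof.
move=> m n; rewrite /scaled_rate !(mulrCA _ _%:R) target_rate_reversible.
by rewrite addSnnS addnC.
Qed.

End Rates.

Theorem theorem3p9 (R : realType) (q : R) (hq0 : 0 <= q) (hq1 : q <> 1)
    (g : nat -> R) (hg : forall n, 0 < g n) :
  (exists u : nat -> nat -> R,
     [/\ rate_function u,
         factorised q u,
         one_point q u (fun x n => x ^+ n * g n)
       & forall v : nat -> nat -> R,
           rate_function v ->
           factorised q v ->
           one_point q v (fun x n => x ^+ n * g n) ->
           exists2 c : R, 0 < c & forall m n, v m n = c * u m n])
  /\
  (exists u : nat -> nat -> R,
     [/\ rate_function u,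
         ~ factorised q u,
         hom_factorised q u
       & hom_one_point q u g])
  /\
  (exists u : nat -> nat -> R,
     rate_function u /\
     ~ hom_factorised q u /\
     factorised 1 u /\
     one_point 1 u (fun x n => x ^+ n * g n) /\
     hom_factorised 1 u /\
     hom_one_point 1 u g).
Proof.
split; last split.
- have op : one_point q (target_rate g) (fun x n => x ^+ n * g n).
    apply: reversible_one_point => //; first exact: target_rate_reversible.
    move=> L N x xi; rewrite big1 ?mulr0 // => l _.
    by rewrite net_inflow_indep_source0 ?mulr0 // => -[].
  exists (target_rate g); split=> //; first exact: target_rateP.
    by exists (fun x n => x ^+ n * g n).
  move=> v [v_gt0 v0] fac opv.
  exists (g 0%N / g 1%N * v 1%N 0%N).
    by rewrite mulr_gt0 ?v_gt0 // divr_gt0.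
  move=> [|m] n; first by rewrite v0 /target_rate mulr0.
  rewrite (factorised_indep_source hq0 hq1 fac n (ltn0Sn m) (ltn0Sn 0)) /target_rate /=.
  (* Detailed balance between (1, n) and (0, n.+1): the reversed hop has an
     empty target, so its rate is the same for all n. *)
  have := one_point_balance hq0 opv ltr01 ltr01 0 n.
  rewrite (factorised_indep_source hq0 hq1 fac 0 (ltn0Sn n) (ltn0Sn 0)).
  rewrite !expr1n !mul1r => bal.
  have g_neq0 k := lt0r_neq0 (hg k).
  apply: (mulfI (mulf_neq0 (g_neq0 1%N) (g_neq0 n))); rewrite bal.
  by field; rewrite !g_neq0.
- have op : hom_one_point q (bumped_rate g) g.
    apply: reversible_hom_one_point => //; first exact: bumped_rate_reversible.
    move=> L N xi.
    suff -> : \sum_(l < L) net_inflow (bumped_rate g) xi l = 0 by rewrite mulr0.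
    apply: (net_inflow_sum0 xi (@bumped_rate_empty _ g)).
    exact: bumped_rate_cocycle.
  exists (bumped_rate g); split=> //; first exact: bumped_rateP.
    move=> fac; have := factorised_indep_source hq0 hq1 fac 1 (ltn0Sn 1) (ltn0Sn 0).
    rewrite /bumped_rate /= addr0 => /eqP.
    rewrite eq_sym addrC -subr_eq subrr eq_sym (negPf (lt0r_neq0 _)) //.
    by rewrite divr_gt0 // mulr_gt0.
  by exists g.
- have op : one_point 1 (scaled_rate g) (fun x n => x ^+ n * g n).
    apply: reversible_one_point => //; first exact: scaled_rate_reversible.
    by move=> L N x xi; rewrite subrr mul0r.
  have hop : hom_one_point 1 (scaled_rate g) g.
    apply: reversible_hom_one_point => //; first exact: scaled_rate_reversible.
    by move=> L N xi; rewrite subrr mul0r.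
  exists (scaled_rate g); split; first exact: scaled_rateP.
  split.
    move=> fac.
    have := hom_factorised_empty_target hq0 hq1 fac (ltn0Sn 1) (ltn0Sn 0).
    have r0 : g 1%N / g 0%N != 0 by rewrite lt0r_neq0 // divr_gt0.
    by rewrite /scaled_rate /target_rate /= => /(mulIf r0)/eqP; rewrite eqr_nat.
  split; first by exists (fun x n => x ^+ n * g n).
  by split=> //; split=> //; exists g.
Qed.
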